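(* Let $\mathcal{A}$ be a finite Abelian group, $p$ a prime, $k\ge1$, and $t:\mathcal{A}^3\to\mathbb{Z}_{p^k}$. Let $N$ be the minimal positive integer for which there are functions $a,b,c:\mathcal{A}\to\mathbb{Z}_{p^kN}$ with $a(x)+b(y)+c(z)=N\cdot t(x,y,z)\pmod{p^kN}$ for all $(x,y,z)\in\mathcal{A}^3$ with $x+y+z=0$, and suppose such $N$ exists and $N>1$. Then there is a constant $c=c(t,\mathcal{A})>0$ such that for all $n$ and all $f,g,h:\mathcal{A}^n\to\mathbb{Z}_{p^k}^n$, $$\Pr_{\substack{(x,y,z)\in(\mathcal{A}^n)^3\\ x+y+z=0}}\big[f(x)_i+g(y)_i+h(z)_i=t(x_i,y_i,z_i)\pmod{p^k},\ i=1,\dots,n\big]\le 2^{-cn},$$ where $(x,y,z)$ is uniform among triples in $(\mathcal{A}^n)^3$ with $x+y+z=0$. *)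

(* Defs.v *)
From Stdlib Require Import Reals.
From HB Require Import structures.
From mathcomp Require Import all_boot all_order all_algebra.
Set Implicit Arguments. Unset Strict Implicit. Unset Printing Implicit Defensive.
Import GRing.Theory.
Local Open Scope ring_scope.

(* N is admissible for t: there are a,b,c : A -> Z_{p^k N} (represented by
   nat-valued functions read modulo p^k N) with
   a x + b y + c z = N * t(x,y,z) mod p^k N whenever x + y + z = 0. *)
Definition admissible (A : finZmodType) (p k : nat)
    (t : A -> A -> A -> 'Z_(p ^ k)) (N : nat) : Prop :=
  exists a b c : A -> nat,
    forall x y z : A, x + y + z = 0 ->
      (a x + b y + c z = N * (t x y z : nat) %[mod p ^ k * N])%N.

Definition zero_sum_triples (A : finZmodType) (n : nat) :
    {set 'rV[A]_n * 'rV[A]_n * 'rV[A]_n} :=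
  [set w | w.1.1 + w.1.2 + w.2 == 0].

Definition good_triples (A : finZmodType) (p k n : nat)
    (t : A -> A -> A -> 'Z_(p ^ k))
    (f g h : 'rV[A]_n -> 'rV['Z_(p ^ k)]_n) :
    {set 'rV[A]_n * 'rV[A]_n * 'rV[A]_n} :=
  [set w in zero_sum_triples A n |
    [forall i : 'I_n,
       f w.1.1 ord0 i + g w.1.2 ord0 i + h w.2 ord0 i
       == t (w.1.1 ord0 i) (w.1.2 ord0 i) (w.2 ord0 i)]].

Definition success_prob (A : finZmodType) (p k n : nat)
    (t : A -> A -> A -> 'Z_(p ^ k))
    (f g h : 'rV[A]_n -> 'rV['Z_(p ^ k)]_n) : R :=
  Rdiv (INR #|good_triples t f g h|) (INR #|zero_sum_triples A n|).

(* Main.v *)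
(** Let M = p^k N and put F(x)_i = N f(x)_i - a(x_i) in Z_M, and similarly G, H,
    so that every successful triple satisfies F(x) + G(y) + H(z) = 0.
    If this happens with probability at least 1/K, then by Balog-Szemeredi-Gowers
    the graphs of G and F contain large sets A', B' with |A' + B'| <= K^O(1) |A'|,
    and Petridis' form of Pluennecke's inequality gives a nonempty X in A' with
    |X + m B'| <= K^O(m) |X| for all m.  Minimality of N forces p | N; with
    L = M / p it also provides u in the group with L u = 0 and a(u) <> a(0) mod p,
    as otherwise a - a(0) mod p would lift to a homomorphism to Z_M (duality for
    finite abelian groups), and subtracting that lift from a, b, c would make N / p
    admissible.  Some fibre x0 + {0, ..., p-1}^n u meets B' in at least p^n / K^O(1)
    points; multiplying these points of the graph of F by L collapses the first
    coordinate to L x0 but keeps the second coordinates distinct, because L F(x)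
    only depends on F(x) mod p, that is on a(x) mod p.  Since X lies in a graph,
    X + L B' then contains |X| p^n / K^O(1) distinct elements, so p^n <= K^O(L). *)

Require Import Defs.
From Stdlib Require Import Reals Lra Lia.

(** * Real estimates: exponential decay from a power bound *)

Section RealBounds.
Local Open Scope R_scope.

Lemma Rpower_2_INR (n : nat) : Rpower 2 (INR n) = 2 ^ n.
Proof. apply Rpower_pow; lra. Qed.

Lemma INR_le_pow2 (n : nat) : INR n <= 2 ^ n.
Proof.
induction n as [|n IH]; [simpl; lra|].
rewrite S_INR; simpl; pose proof (pow_R1_Rle 2 n); lra.
Qed.

Lemma ln2_le1 : ln 2 <= 1.
Proof.
destruct (Rle_lt_dec (ln 2) 1) as [le|lt]; [exact le|exfalso].
apply exp_increasing in lt; rewrite exp_ln in lt by lra.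
pose proof (exp_ineq1_le 1); lra.
Qed.

(* P ^ C <= E / 2 ^ n gives decay only once n >= 2 E; below that range the
   uniform bound P <= 1 - 1 / Q takes over. *)
Lemma exponential_decay (C E Q : nat) : (0 < C)%nat -> (0 < E)%nat -> (0 < Q)%nat ->
  exists c, 0 < c /\ forall (n : nat) (P : R), 0 <= P <= 1 ->
    2 ^ n * P ^ C <= INR E ->
    ((0 < n < 2 * E)%nat -> P <= 1 - / INR Q) ->
    P <= Rpower 2 (- (c * INR n)).
Proof.
intros C0 E0 Q0.
assert (C1 : 1 <= INR C) by (apply (le_INR 1); lia).
assert (E1 : 1 <= INR E) by (apply (le_INR 1); lia).
assert (Q1 : 1 <= INR Q) by (apply (le_INR 1); lia).
(* For n >= 2E, E <= 2^E <= 2^(n/2) gives P^C <= 2^(-n/2), hence the rate [c1]. For n < 2E, c2 n <=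
   1/Q and ln 2 <= 1 give 2^(-c2 n) >= exp(-1/Q) >= 1 - 1/Q. *)
pose (c1 := / (2 * INR C)); pose (c2 := / (2 * INR E * INR Q)).
assert (c1_gt0 : 0 < c1) by (apply Rinv_0_lt_compat; nra).
assert (c2_gt0 : 0 < c2) by (apply Rinv_0_lt_compat; apply Rmult_lt_0_compat; nra).
exists (Rmin c1 c2); split; [now apply Rmin_glb_lt|].
intros n P [P0 P1] large small.
assert (mono : forall c, Rmin c1 c2 <= c ->
    Rpower 2 (- (c * INR n)) <= Rpower 2 (- (Rmin c1 c2 * INR n))).
{ intros c le; apply Rle_Rpower; [lra|].
  pose proof (pos_INR n); nra. }
destruct (Nat.eq_dec n 0) as [->|n0].
{ simpl; rewrite Rmult_0_r, Ropp_0, Rpower_O; lra. }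
destruct (Nat.lt_ge_cases n (2 * E)) as [lt|ge].
- apply Rle_trans with (2 := mono c2 (Rmin_r _ _)).
  apply Rle_trans with (1 := small (conj (proj1 (Nat.neq_0_lt_0 n) n0) lt)).
  apply Rle_trans with (exp (- / INR Q)).
  { pose proof (exp_ineq1_le (- / INR Q)); lra. }
  unfold Rpower.
  assert (h : - / INR Q <= - (c2 * INR n) * ln 2).
  { assert (n2 : INR n <= 2 * INR E)
      by (apply lt_INR in lt; rewrite mult_INR in lt; simpl in lt; lra).
    assert (q0 : 0 < / INR Q) by (apply Rinv_0_lt_compat; lra).
    assert (ce : c2 * (2 * INR E) = / INR Q) by (unfold c2; field; lra).
    pose proof (pos_INR n); pose proof ln2_le1.
    assert (l0 : 0 <= ln 2) by (pose proof ln_lt_2; lra).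
    assert (c2 * INR n <= / INR Q) by (rewrite <- ce; nra).
    assert (0 <= c2 * INR n) by nra.
    nra. }
  destruct h as [h|h]; [left; now apply exp_increasing|right; now rewrite h].
- apply Rle_trans with (2 := mono c1 (Rmin_l _ _)).
  destruct (Rle_lt_dec P (Rpower 2 (- (c1 * INR n)))) as [ok|bad]; [exact ok|exfalso].
  assert (pw : Rpower 2 (- (c1 * INR n)) ^ C < P ^ C).
  { assert (r0 : 0 < Rpower 2 (- (c1 * INR n))) by apply exp_pos.
    revert bad r0; generalize (Rpower 2 (- (c1 * INR n))); intros r bad r0.
    clear - C0 bad r0; induction C0 as [|m C0 IH]; simpl; [lra|].
    apply Rmult_le_0_lt_compat; [lra|apply pow_le; lra|lra|exact IH]. }
  rewrite <- Rpower_pow, Rpower_mult in pw by apply exp_pos.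
  replace (- (c1 * INR n) * INR C) with (- (INR n / 2)) in pw
    by (unfold c1; field; lra).
  assert (p2 : 0 < 2 ^ n) by (apply pow_lt; lra).
  assert (lt : 2 ^ n * Rpower 2 (- (INR n / 2)) < INR E) by nra.
  rewrite <- Rpower_2_INR, <- Rpower_plus in lt.
  assert (le : Rpower 2 (INR E) <= Rpower 2 (INR n + - (INR n / 2))).
  { apply Rle_Rpower; [lra|]; apply le_INR in ge; rewrite mult_INR in ge; simpl in ge; lra. }
  rewrite Rpower_2_INR in le; pose proof (INR_le_pow2 E); lra.
Qed.

End RealBounds.

From HB Require Import structures.
From mathcomp Require Import all_boot fingroup all_order all_algebra.
From mathcomp Require Import zify ring.
Set Implicit Arguments. Unset Strict Implicit. Unset Printing Implicit Defensive.
Import GRing.Theory Num.Theory.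
Local Open Scope ring_scope.

(** * Sumsets: Petridis and Pluennecke *)

Section Sumsets.
Variable V : finZmodType.
Implicit Types A B C X Z : {set V}.

Definition sumset A B : {set V} := [set u + v | u in A, v in B].

Definition iter_sumset A B (m : nat) : {set V} := iter m (sumset^~ B) A.

Lemma mem_sumset A B u v : u \in A -> v \in B -> u + v \in sumset A B.
Proof. by move=> uA vB; apply/imset2P; exists u v. Qed.

Lemma sumsetS A B C : A \subset B -> sumset A C \subset sumset B C.
Proof.
move=> /subsetP sAB; apply/subsetP => w /imset2P[u v uA vC ->].
by apply: mem_sumset => //; apply: sAB.
Qed.

Lemma sumsetAC A B C : sumset (sumset A B) C = sumset (sumset A C) B.
Proof.
have sub A1 B1 C1 : sumset (sumset A1 B1) C1 \subset sumset (sumset A1 C1) B1.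
  apply/subsetP => w /imset2P[u v /imset2P[a b aA bB ->] vC ->].
  by rewrite addrAC; do 2?apply: mem_sumset.
by apply/eqP; rewrite eqEsubset !sub.
Qed.

Lemma card_translate A c : #|[set u + c | u in A]| = #|A|.
Proof. by rewrite card_imset //; apply: addIr. Qed.

Lemma sumset_setU1 A C c :
  sumset A (c |: C) = sumset A C :|: [set u + c | u in A].
Proof.
apply/setP=> w; rewrite inE; apply/imset2P/orP.
  case=> u v uA; rewrite !inE => /orP[/eqP-> ->|vC ->].
    by right; apply/imsetP; exists u.
  by left; apply: mem_sumset.
case=> [/imset2P[u v uA vC ->]|/imsetP[u uA ->]].
  by exists u v; rewrite // !inE vC orbT.
by exists u c; rewrite // !inE eqxx.
Qed.

(* Petridis' lemma: the set of translates x + c + B already covered by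
   X + B + C is controlled by the minimality of the ratio |Z + B| / |Z|. *)
Lemma petridis X B :
  (forall Z, Z \subset X -> #|sumset X B| * #|Z| <= #|sumset Z B| * #|X|)%N ->
  forall C, (#|sumset (sumset X B) C| * #|X| <= #|sumset X B| * #|sumset X C|)%N.
Proof.
move=> Xmin C0; have [m] := ubnP #|C0|; elim: m C0 => // m IHm C0 ltC0.
have [->|[c cC0]] := set_0Vmem C0.
  suff ->: sumset (sumset X B) set0 = set0 by rewrite cards0.
  by apply/setP=> w; rewrite inE; apply/imset2P; case=> u v _; rewrite inE.
rewrite -(setD1K cC0); set C := C0 :\ c.
have IH : (#|sumset (sumset X B) C| * #|X| <= #|sumset X B| * #|sumset X C|)%N.
  by apply: IHm; move: ltC0; rewrite (cardsD1 c) cC0.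
pose Z := [set x in X | [set u + c | u in sumset [set x] B]
                          \subset sumset (sumset X B) C].
have ZX : Z \subset X by apply/subsetP=> x; rewrite inE => /andP[].
pose tr (D : {set V}) : {set V} := [set u + c | u in D].
have trS (D D' : {set V}) : D \subset D' -> tr D \subset tr D' by apply: imsetS.
(* Of the translate X + B + c, the part Z + B + c already lies in X + B + C and adds nothing. *)
have h1 : (#|sumset (sumset X B) (c |: C)| + #|sumset Z B| <=
           #|sumset (sumset X B) C| + #|sumset X B|)%N.
  rewrite sumset_setU1 -/(tr _).
  have ZB : tr (sumset Z B) \subset tr (sumset X B) by apply/trS/sumsetS.
  have ZC : tr (sumset Z B) \subset sumset (sumset X B) C.
    apply/subsetP => w /imsetP[v /imset2P[z b]].
    rewrite inE => /andP[_ /subsetP sz] bB -> ->; apply: sz.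
    by apply/imsetP; exists (z + b) => //; apply: mem_sumset => //; apply/set11.
  have := cardsUI (sumset (sumset X B) C) (tr (sumset X B)).
  have : (#|tr (sumset Z B)| <= #|sumset (sumset X B) C :&: tr (sumset X B)|)%N.
    by apply: subset_leq_card; rewrite subsetI ZC ZB.
  by rewrite /tr !card_translate; lia.
(* Conversely, x + c in X + C forces x + c + B into X + B + C, that is x in Z. *)
have h2 : (#|sumset X C| + #|X| <= #|sumset X (c |: C)| + #|Z|)%N.
  rewrite sumset_setU1 -/(tr _).
  have := cardsUI (sumset X C) (tr X).
  suff : (#|sumset X C :&: tr X| <= #|tr Z|)%N by rewrite /tr !card_translate; lia.
  apply/subset_leq_card/subsetP => w; rewrite inE => /andP[wXC /imsetP[x xX wE]].
  apply/imsetP; exists x => //; rewrite inE xX /=; apply/subsetP => w'.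
  case/imsetP => _ /imset2P[x' b /set1P -> bB ->] ->.
  by rewrite addrAC -wE sumsetAC; apply: mem_sumset.
have := Xmin Z ZX; nia.
Qed.

(** Descent on |A|: either A minimizes |Z + B| / |Z|, or some Z in A has a strictly smaller ratio,
    is then a proper subset, and replaces A. Ratios are cross-multiplied to stay in [nat]. *)
Lemma exists_min_ratio A B : A != set0 ->
  exists X, [/\ X \subset A, X != set0,
    #|sumset X B| * #|A| <= #|sumset A B| * #|X| &
    forall Z, Z \subset X -> #|sumset X B| * #|Z| <= #|sumset Z B| * #|X|]%N.
Proof.
move: {2}_.+1 (ltnSn #|A|) => m; elim: m A => // m IH A ltAm A0.
have [/existsP[Z /andP[ZA ltZ]]|/existsPn nZ] := boolP [exists Z : {set V},
   (Z \subset A) && (#|sumset Z B| * #|A| < #|sumset A B| * #|Z|)%N]; last first.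
  exists A; split=> // Z ZA; have := nZ Z; rewrite ZA /=; lia.
have Z0 : Z != set0.
  by apply/eqP=> Z0; move: ltZ; rewrite Z0 cards0 muln0.
have ZpA : Z \proper A.
  rewrite properEneq ZA andbT; apply/eqP => ZE; move: ltZ; rewrite ZE; lia.
have [|X [XZ X0 XZm Xm]] := IH Z _ Z0; first by have := proper_card ZpA; lia.
exists X; split=> //; first exact: subset_trans ZA.
have z0 : (0 < #|Z|)%N by rewrite card_gt0.
by rewrite -(leq_pmul2r z0); nia.
Qed.

(** For X of minimal ratio, [petridis] with C = mB shows that each further summand B costs a factor
    of at most |X + B| / |X| <= K. *)
Lemma plunnecke A B (K : nat) : A != set0 -> (#|sumset A B| <= K * #|A|)%N ->
  exists X, [/\ X \subset A, X != set0 &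
    forall m, #|iter_sumset X B m| <= K ^ m * #|X|]%N.
Proof.
move=> A0 AB; have [X [XA X0 XAm Xm]] := exists_min_ratio B A0.
exists X; split=> // m.
have a0 : (0 < #|A|)%N by rewrite card_gt0.
have x0 : (0 < #|X|)%N by rewrite card_gt0.
have XB : (#|sumset X B| <= K * #|X|)%N by rewrite -(leq_pmul2r a0); nia.
have expand m' : exists C, iter_sumset X B m'.+1 = sumset (sumset X B) C
                       /\ iter_sumset X B m' = sumset X C.
  elim: m' => [|m' [C [IH1 IH2]]].
    exists [set 0]; rewrite /iter_sumset /=; split.
      apply/setP=> w; apply/idP/imset2P => [wX|[u v uX /set1P-> ->]].
        by exists w 0; rewrite ?set11 ?addr0.
      by rewrite addr0.
    apply/setP=> w; apply/idP/imset2P => [wX|[u v uX /set1P-> ->]].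
      by exists w 0; rewrite ?set11 ?addr0.
    by rewrite addr0.
  exists (sumset C B).
  have assoc D : sumset (sumset D C) B = sumset D (sumset C B).
    apply/setP=> w; apply/imset2P/imset2P => [[u v /imset2P[d c dD cC ->] vB ->]|].
      by exists d (c + v); rewrite ?addrA //; apply: mem_sumset.
    case=> d _ dD /imset2P[c b cC bB ->] ->.
    by exists (d + c) b; rewrite ?addrA //; apply: mem_sumset.
  by rewrite -!assoc -IH1 -IH2.
elim: m => [|m IH]; first by rewrite mul1n.
have [C [E1 E2]] := expand m.
have := petridis Xm C; rewrite -E1 -E2 => h.
rewrite -(leq_pmul2r x0) expnS; apply: (leq_trans h).
apply: leq_trans (leq_mul XB IH) _; nia.
Qed.

End Sumsets.

(** * Paths of length three and Balog-Szemeredi-Gowers *)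

Section ThreePaths.
Local Open Scope nat_scope.
Variables (T : finType) (E : rel T) (K : nat).
Let n := #|T|.
Implicit Types (x y : T).

Let deg x := #|[set y | E x y]|.
Let codeg x x' := #|[set y | E x y && E x' y]|.

(** [E] is read as a bipartite graph between two copies of [T]; [q] holds the inner vertices of a
    path x - q.2 - q.1 - y, with [q.1] on the side of x. *)
Definition paths3 x y : {set T * T} :=
  [set q : T * T | [&& E x q.2, E q.1 q.2 & E q.1 y]].

Lemma sum_card_exchange (P : pred T) (R : rel T) :
  \sum_(x | P x) #|[set y | R x y]| = \sum_y #|[set x | P x && R x y]|.
Proof.
under eq_bigr => x _ do rewrite -sum1_card big_mkcond.
rewrite exchange_big; apply: eq_bigr => y _.
rewrite -sum1_card -big_mkcondr; apply: eq_bigl => x; rewrite !inE //=.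
Qed.

Lemma exists_ltn_sum (F G : T -> nat) :
  \sum_x F x < \sum_x G x -> exists x, F x < G x.
Proof.
move=> lt; apply/existsP; apply: contraLR lt => /existsPn h.
by rewrite -leqNgt; apply: leq_sum => x _; rewrite leqNgt.
Qed.

(** [P0] keeps the vertices of degree at least n / 2K; a pair is [bad] if it has fewer than n / 256
    K^3 common neighbours. *)
Let P0 x := n <= 2 * K * deg x.
Let A1 b := [set x | P0 x && E x b].
Let bad x x' := codeg x x' * (256 * K ^ 3) < n.
Let badset b x := [set x' in A1 b | bad x x'].

Hypothesis n_gt0 : 0 < n.
Hypothesis dense : n ^ 2 <= K * #|[set q : T * T | E q.1 q.2]|.

Let K_gt0 : 0 < K.
Proof.
have := dense; rewrite lt0n; apply: contraL => /eqP->.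
by rewrite mul0n -ltnNge expn_gt0 n_gt0.
Qed.

(** Vertices outside [P0] carry at most n^2 / 2K edges, half of what [dense] guarantees. *)
Let dense0 : n ^ 2 <= 2 * K * \sum_b #|A1 b|.
Proof.
have -> : \sum_b #|A1 b| = \sum_(x | P0 x) deg x by rewrite (sum_card_exchange P0 E).
have tot : #|[set q : T * T | E q.1 q.2]| = \sum_x deg x.
  under eq_bigr => x _ do rewrite /deg -sum1_card.
  by rewrite pair_big_dep -sum1_card /=; apply: eq_bigl => q; rewrite !inE.
have : 2 * K * \sum_(x | ~~ P0 x) deg x <= n * n.
  rewrite -[n * n](sum_nat_const T) big_distrr /= big_mkcond /=.
  by apply: leq_sum => x _; case: ifP => //; rewrite /P0 -ltnNge => /ltnW.
by move: dense; rewrite tot (bigID P0) /= -!mulnn; lia.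
Qed.

(** A bad pair lies in A1 b for fewer than n / 256 K^3 vertices b, so there are few bad pairs in
    total, while Cauchy-Schwarz gives sum |A1 b|^2 >= n^3 / 4 K^2; averaging over b yields the
    vertex. *)
Let vertex : exists b, 0 < #|A1 b| /\ n <= 3 * K * #|A1 b| /\
  32 * K * \sum_(x in A1 b) #|badset b x| <= #|A1 b| ^ 2.
Proof.
have sq : n ^ 3 <= 4 * K ^ 2 * \sum_b #|A1 b| ^ 2.
  have h b : 4 * K * n * #|A1 b| <= 4 * K ^ 2 * #|A1 b| ^ 2 + n ^ 2.
    by have [] := nat_Cauchy (2 * K * #|A1 b|) n; rewrite -!mulnn; lia.
  have : \sum_b 4 * K * n * #|A1 b| <= \sum_b (4 * K ^ 2 * #|A1 b| ^ 2 + n ^ 2).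
    by apply: leq_sum => b _.
  rewrite big_split /= -!big_distrr /= sum_nat_const -/n.
  by have := leq_mul (leqnn (2 * n)) dense0; rewrite !expnS !expn0; lia.
have badsum : 256 * K ^ 3 * \sum_b \sum_(x in A1 b) #|badset b x| <= n ^ 3.
  have -> : \sum_b \sum_(x in A1 b) #|badset b x| =
            \sum_(q : T * T | [&& P0 q.1, P0 q.2 & bad q.1 q.2]) codeg q.1 q.2.
    under [RHS]eq_bigr => q _ do rewrite /codeg -sum1_card big_mkcond.
    rewrite exchange_big; apply: eq_bigr => b _.
    under eq_bigr => x _ do rewrite -sum1_card.
    rewrite pair_big_dep -big_mkcondr /=; apply: eq_bigl => -[x x'] /=.
    by rewrite !inE; case: (P0 x); case: (P0 x'); case: (E x b); case: (E x' b); case: (bad x x').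
  rewrite big_distrr /=.
  apply: (@leq_trans (\sum_(q : T * T) n)).
    by rewrite big_mkcond; apply: leq_sum => q _; case: ifP => // /and3P[_ _ /ltnW]; rewrite mulnC.
  by rewrite sum_nat_const card_prod -/n !expnS expn0; lia.
(* Summed over b, the first function is at most n^3 + n (n^2 - 1) < 2 n^3 and the second at least 2
   n^3. The [.-1] gives strictness and still leaves n^2 <= 8 K^2 |A1 b|^2. *)
have [|b hb] := @exists_ltn_sum
   (fun b => 8 * K ^ 2 * (32 * K * \sum_(x in A1 b) #|badset b x|) + (n ^ 2).-1)
   (fun b => 8 * K ^ 2 * #|A1 b| ^ 2).
  rewrite big_split /= -!big_distrr /= sum_nat_const -/n.
  have : n * (n ^ 2).-1 < n ^ 3.
    by rewrite [n ^ 3]expnS ltn_mul2l n_gt0 ltn_predL expn_gt0 n_gt0.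
  by move: sq badsum; rewrite !expnS !expn0; lia.
have h1 : 8 * K ^ 2 * (32 * K * \sum_(x in A1 b) #|badset b x|) <= 8 * K ^ 2 * #|A1 b| ^ 2 by lia.
have h2 : n ^ 2 <= 8 * K ^ 2 * #|A1 b| ^ 2 by lia.
have h3 : n <= 3 * K * #|A1 b|.
  by rewrite -leq_sqr; apply: leq_trans h2 _; rewrite !expnS !expn0; lia.
exists b; split; first by case: posnP h3 => // ->; rewrite muln0 leqNgt n_gt0.
split=> //; move: h1; rewrite leq_pmul2l //.
by rewrite muln_gt0 expn_gt0 K_gt0.
Qed.

(* A consists of the neighbours x of a suitable vertex that form a bad pair (few
   common neighbours) with at most a 1 / 16K fraction of them, and B of the y
   joined to at least a 1 / 4K fraction of A: most neighbours of y in A are then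
   good for x. *)
Lemma three_paths : exists A B : {set T},
  [/\ 0 < #|A|, n <= 6 * K * #|A|, n <= 4 * K * #|B| &
   {in A & B, forall x y, n ^ 2 <= 48 * 256 * K ^ 5 * #|paths3 x y|}].
Proof.
have [b [A1_gt0 [nA1 badA1]]] := vertex.
pose A := [set x in A1 b | 16 * K * #|badset b x| <= #|A1 b|].
pose B := [set y | #|A| <= 4 * K * #|[set x | (x \in A) && E x y]|].
have AA1 : A \subset A1 b by apply/subsetP => x; rewrite inE => /andP[].
have cA : #|A1 b| <= 2 * #|A|.
  have : #|A1 b :\: A| * #|A1 b| <= 16 * K * \sum_(x in A1 b) #|badset b x|.
    rewrite -sum_nat_const big_distrr /= [X in _ <= X](big_setID A) /= (setIidPr AA1).
    apply: leq_trans (leq_addl _ _); apply: leq_sum => x.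
    by rewrite !inE => /andP[]; rewrite negb_and => /orP[/negP//|]; rewrite -ltnNge => /ltnW.
  have : #|A1 b :\: A| = #|A1 b| - #|A| by rewrite cardsD (setIidPr AA1).
  have := subset_leq_card AA1.
  move: badA1; rewrite -mulnn => h1 h2 h3 h4.
  suff : 2 * #|A1 b :\: A| <= #|A1 b| by lia.
  by rewrite -(leq_pmul2r A1_gt0); lia.
have A_gt0 : 0 < #|A| by lia.
have cB : n <= 4 * K * #|B|.
  have e1 : #|A| * n <= 2 * K * \sum_y #|[set x | (x \in A) && E x y]|.
    rewrite -(sum_card_exchange (mem A) E) -sum_nat_const big_distrr /=.
    by apply: leq_sum => x /(subsetP AA1); rewrite inE => /andP[].
  have e2 : 4 * K * \sum_(y | y \notin B) #|[set x | (x \in A) && E x y]| <= #|A| * n.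
    rewrite [#|A| * n]mulnC -[n * _](sum_nat_const T) big_distrr /= big_mkcond /=.
    by apply: leq_sum => y _; case: ifP => //; rewrite inE -ltnNge => /ltnW.
  have e3 : \sum_(y in B) #|[set x | (x \in A) && E x y]| <= #|B| * #|A|.
    rewrite -sum_nat_const; apply: leq_sum => y _.
    by apply/subset_leq_card/subsetP => x; rewrite inE => /andP[].
  move: e1; rewrite (bigID (mem B)) /= => e1.
  by rewrite -(leq_pmul2l A_gt0); have := leq_mul (leqnn (4 * K)) e3; lia.
exists A, B; split=> //; first by have := leq_mul (leqnn (3 * K)) cA; lia.
move=> x y xA; rewrite inE => yB.
(* At least |A1 b| / 8K neighbours of y lie in A and at most |A1 b| / 16K of them are bad for x;
   each of the others shares n / 256 K^3 neighbours with x. *)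
pose G := [set x' | (x' \in A) && E x' y] :\: badset b x.
have cG : #|A1 b| <= 16 * K * #|G|.
  have : #|[set x' | (x' \in A) && E x' y]| <= #|G| + #|badset b x|.
    rewrite -(cardsID (badset b x)) addnC leq_add2l; apply: subset_leq_card.
    exact: subsetIr.
  move: xA; rewrite inE => /andP[_].
  by move=> h /(leq_mul (leqnn (4 * (4 * K)))); lia.
have codegG x' : x' \in G -> n <= 256 * K ^ 3 * codeg x x'.
  rewrite !inE => /andP[nb /andP[/andP[x'A _] _]]; move: nb.
  by rewrite x'A /= /bad -leqNgt mulnC.
have sumG : \sum_(x' in G) codeg x x' <= #|paths3 x y|.
  under eq_bigr => x' _ do rewrite /codeg -sum1_card.
  rewrite pair_big_dep sum1_card /=; apply/subset_leq_card/subsetP => -[x' z].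
  have h : forall P : pred (T * T), (x', z) \in P -> P (x', z) by [].
  move/h; rewrite [(_, _) \in _]inE /= => /andP[].
  by rewrite !inE => /andP[_ /andP[_ ->]] /andP[-> ->].
have sumG' : #|G| * n <= 256 * K ^ 3 * \sum_(x' in G) codeg x x'.
  by rewrite -sum_nat_const big_distrr; apply: leq_sum.
move: nA1 cG sumG sumG'; move: #|A1 b| #|G| #|paths3 x y| (\sum_(_ in _) _) n.
move=> a1 c P S m h4 h3 h1 h2.
have {}h1 := leq_mul (leqnn (256 * K ^ 3 * (48 * K ^ 2))) h1.
have {}h2 := leq_mul (leqnn (48 * K ^ 2)) h2.
have {}h3 := leq_mul (leqnn (3 * K * m)) h3.
have {}h4 := leq_mul (leqnn m) h4.
by move: h1 h2 h3 h4; rewrite !expnS !expn0; lia.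
Qed.
End ThreePaths.

(* A path x - b - a - y writes phi x + theta y as
   (phi x + theta b) - (phi a + theta b) + (phi a + theta y), so elements of the
   sumset have many representations in S - S + S. *)
Lemma balog_szemeredi_gowers (T : finType) (V : finZmodType) (phi theta : T -> V)
    (S : {set V}) (K : nat) :
  (0 < #|T|)%N -> (#|S| <= #|T|)%N -> injective phi -> injective theta ->
  (#|T| ^ 2 <= K * #|[set q : T * T | (phi q.1 + theta q.2 \in S)%R]|)%N ->
  exists A B : {set T}, [/\ A != set0, (#|T| <= 4 * K * #|B|)%N &
    (#|sumset (phi @: A) (theta @: B)| <= 288 * 256 * K ^ 6 * #|phi @: A|)%N].
Proof.
move=> T_gt0 leST phi_inj theta_inj dense; pose E x y := phi x + theta y \in S.
have [A [B [A_gt0 nA nB paths]]] := @three_paths T E K T_gt0 dense.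
exists A, B; split=> //; first by rewrite -card_gt0.
set W := sumset _ _; rewrite card_imset //.
pose reps w := [set s : V * V * V | [&& s.1.1 \in S, s.1.2 \in S, s.2 \in S &
                                      s.1.1 - s.1.2 + s.2 == w]].
have reps_ge w : w \in W -> (#|T| ^ 2 <= 48 * 256 * K ^ 5 * #|reps w|)%N.
  case/imset2P => _ _ /imsetP[x xA ->] /imsetP[y yB ->] ->.
  apply: leq_trans (paths x y xA yB) _; rewrite leq_mul2l; apply/orP; right.
  pose tr (q : T * T) := (phi x + theta q.2, phi q.1 + theta q.2, phi q.1 + theta y).
  have tr_inj : injective tr.
    move=> [a b] [a' b'] [_ hb /addIr/phi_inj eqa]; move: hb.
    by rewrite eqa => /addrI/theta_inj->.
  rewrite -(card_imset _ tr_inj); apply/subset_leq_card/subsetP => _ /imsetP[[a b] /= h ->].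
  move: h; rewrite !inE /E /= => /and3P[-> -> ->] /=.
  by apply/eqP; rewrite opprD [_ + (- _ - _)]addrACA subrr addr0 addrA subrK.
have sum_reps : (\sum_(w in W) #|reps w| <= #|T| ^ 3)%N.
  pose val3 (s : V * V * V) := s.1.1 - s.1.2 + s.2.
  apply: (@leq_trans #|setX (setX S S) S|).
    rewrite -[X in (_ <= X)%N]sum1_card (partition_big val3 xpredT) //=.
    rewrite [X in (_ <= X)%N](bigID (mem W)) /=; apply: leq_trans (leq_addr _ _).
    apply: leq_sum => w _; rewrite -sum1_card; apply: eq_leq; apply: eq_bigl => s.
    by rewrite !inE -!andbA.
  by rewrite !cardsX !expnS expn0 muln1 mulnA !leq_mul.
(* Double counting: every w in W has at least |T|^2 / (48 * 256 K^5) representations, and S^3 has at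
   most |T|^3 triples. *)
have cW : (#|W| <= 48 * 256 * K ^ 5 * #|T|)%N.
  have t2 : (0 < #|T| ^ 2)%N by rewrite expn_gt0 T_gt0.
  rewrite -(leq_pmul2r t2) -mulnA -expnS -sum_nat_const.
  apply: leq_trans (leq_mul (leqnn _) sum_reps).
  by rewrite big_distrr /=; apply: leq_sum.
apply: leq_trans cW _; have := leq_mul (leqnn (48 * 256 * K ^ 5)) nA.
by rewrite !expnS !expn0; lia.
Qed.

(** * Lifting homomorphisms *)

Section CharacterExtension.
Variable A : finZmodType.
Implicit Types (B : {set A}) (s : A -> rat).

Definition subgroup B := 0 \in B /\ {in B &, forall x y, x - y \in B}.

(* Maps into Q/Z are represented by rational lifts, equality in Q/Z being
   an integral difference. *)
Definition additive_mod1 B s :=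
  {in B &, forall x y, s (x + y) - s x - s y \in Num.int}.

Lemma int_congr (u v : rat) : u \in Num.int -> u = v -> v \in Num.int.
Proof. by move=> ? <-. Qed.

Section Step.
Variables (B : {set A}) (s : A -> rat) (x : A).
Hypotheses (Bsub : subgroup B) (sB : additive_mod1 B s).

Let B0 : 0 \in B := proj1 Bsub.
Let BB : {in B &, forall x y, x - y \in B} := proj2 Bsub.
Let BN y : y \in B -> - y \in B.
Proof. by move=> yB; rewrite -[- y]add0r; apply: BB. Qed.
Let BD y z : y \in B -> z \in B -> y + z \in B.
Proof. by move=> yB zB; rewrite -[z]opprK; apply: BB => //; apply: BN. Qed.
Let BMn y (m : nat) : y \in B -> y *+ m \in B.
Proof. by move=> yB; elim: m => // m IH; rewrite mulrS; apply: BD. Qed.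
Let BMz y (m : int) : y \in B -> y *~ m \in B.
Proof. by case: m => m yB; [apply: BMn | apply/BN/BMn]. Qed.

Let s0 : s 0 \in Num.int.
Proof. by have := sB B0 B0; rewrite addr0 subrr sub0r rpredN. Qed.

Let sMn y (m : nat) : y \in B -> s (y *+ m) - m%:R * s y \in Num.int.
Proof.
move=> yB; elim: m => [|m IH]; first by rewrite mulr0n mul0r subr0.
apply: int_congr (rpredD (sB yB (BMn m yB)) IH) _; rewrite mulrS.
by rewrite -natr1; ring.
Qed.

Let sN y : y \in B -> s (- y) + s y \in Num.int.
Proof.
by move=> yB; apply: int_congr (rpredB s0 (sB (BN yB) yB)) _; rewrite addNr; ring.
Qed.

Let sMz y (m : int) : y \in B -> s (y *~ m) - m%:~R * s y \in Num.int.
Proof.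
move=> yB; case: m => m; first by rewrite -!pmulrn; apply: sMn.
rewrite NegzE !mulrNz -!pmulrn.
by apply: int_congr (rpredB (sN (BMn m.+1 yB)) (sMn m.+1 yB)) _; ring.
Qed.

Let ex_r : exists m : nat, (0 < m)%N && (x *+ m \in B).
Proof.
by exists #[x]%g; rewrite order_gt0 -FinRing.zmodXgE expg_order.
Qed.

(** The order of x modulo B. *)
Let r := ex_minn ex_r.
Let r_gt0 : (0 < r)%N.
Proof. by rewrite /r; case: ex_minnP => m /andP[]. Qed.
Let xrB : x *+ r \in B.
Proof. by rewrite /r; case: ex_minnP => m /andP[]. Qed.

Let dvd_r (m : int) : x *~ m \in B -> (r %| m)%Z.
Proof.
move=> xmB; have r0 : r%:Z != 0 by rewrite eqz_nat -lt0n.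
have xmodB : x *~ (m %% r)%Z \in B.
  have -> : (m %% r)%Z = m - r%:Z * (m %/ r)%Z by rewrite mulrC {2}(divz_eq m r); ring.
  by rewrite mulrzBr; apply: BB => //; rewrite mulrzA; apply: BMz; rewrite -pmulrn.
apply/dvdz_mod0P; have := modz_ge0 m r0; have := ltz_mod m r0.
case: (m %% r)%Z xmodB => // i; rewrite -pmulrn => iB /=.
rewrite ltz_nat => lti _; case: (posnP i) => [->//|i0].
move: lti; rewrite ltnNge /r; case: ex_minnP => q _ /(_ i).
by rewrite i0 iB => /(_ isT) ->.
Qed.

(** The value to be given to x: the only constraint is r v = s(r x) modulo 1, solvable because Q/Z
    is divisible. *)
Let v : rat := s (x *+ r) / r%:R.

Let s_mult (m : int) : x *~ m \in B -> s (x *~ m) - m%:~R * v \in Num.int.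
Proof.
case/dvd_r/dvdzP => q -> ; rewrite mulrC mulrzA -pmulrn.
apply: int_congr (sMz q xrB) _.
have r0 : r%:R != 0 :> rat by rewrite pnatr_eq0 -lt0n.
by rewrite /v intrM -pmulrn; field.
Qed.

Definition adjoin : {set A} := [set y | [exists i : 'I_r, y - x *+ i \in B]].

Let idx y : nat := find (fun i => y - x *+ i \in B) (iota 0 r).

Let idxP y : y \in adjoin -> y - x *+ idx y \in B.
Proof.
rewrite inE => /existsP[i iB].
have h : has (fun i => y - x *+ i \in B) (iota 0 r).
  by apply/hasP; exists (val i); rewrite // mem_iota /=.
have := nth_find 0%N h; rewrite nth_iota ?add0n //.
by rewrite -{2}(size_iota 0 r) -has_find.
Qed.

Let adjoinE y (m : int) : y - x *~ m \in B -> y \in adjoin.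
Proof.
have r0 : r%:Z != 0 by rewrite eqz_nat -lt0n.
move=> ymB; rewrite inE; apply/existsP.
have := modz_ge0 m r0; have := ltz_mod m r0; case E: (m %% r)%Z => [i|//].
rewrite ltz_nat => lti _; exists (Ordinal lti) => /=.
have -> : y - x *+ i = y - x *~ m + x *+ r *~ (m %/ r)%Z.
  have {1}-> : m = r%:Z * (m %/ r)%Z + i%:Z by rewrite mulrC -E -divz_eq.
  by rewrite mulrzDr mulrzA -!pmulrn opprD addrA addrAC subrK.
by apply: BD => //; apply: BMz.
Qed.

Let sub_adjoin : B \subset adjoin.
Proof.
by apply/subsetP => y yB; apply: (@adjoinE y 0); rewrite mulr0z subr0.
Qed.

Let x_adjoin : x \in adjoin.
Proof. by apply: (@adjoinE x 1); rewrite mulr1z subrr. Qed.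

Let adjoin_subgroup : subgroup adjoin.
Proof.
split=> [|y z /idxP yB /idxP zB]; first exact: (subsetP sub_adjoin).
apply: (@adjoinE _ ((idx y)%:Z - (idx z)%:Z)).
rewrite mulrzBr -!pmulrn.
have -> : y - z - (x *+ idx y - x *+ idx z) = (y - x *+ idx y) - (z - x *+ idx z).
  by rewrite !opprD !opprK !addrA; congr (_ + _); rewrite addrAC.
exact: BB.
Qed.

Let s' y : rat := s (y - x *+ idx y) + (idx y)%:R * v.

Let s'_additive : additive_mod1 adjoin s'.
Proof.
move=> y z yA zA.
have yzA : y + z \in adjoin.
  have [A0 AB] := adjoin_subgroup.
  by rewrite -[z]opprK; apply: (AB) => //; rewrite -[- z]add0r; apply: AB.
move: (idxP yA) (idxP zA) (idxP yzA); rewrite /s'.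
set i := idx y; set j := idx z; set k := idx (y + z).
set u := y - _; set w := z - _; set q := y + z - _ => uB wB qB.
(* The carry in adding coset indices; x *~ m lies in B, so [s_mult] absorbs it. *)
pose m : int := i%:Z + j%:Z - k%:Z.
have qE : q = (u + w) + x *~ m.
  rewrite /q /u /w /m mulrzBr mulrzDr -!pmulrn [y - _ + _]addrACA -opprD.
  by rewrite addrA subrK.
have xmB : x *~ m \in B.
  have -> : x *~ m = q - (u + w) by rewrite qE addrAC subrr add0r.
  by apply: BB => //; apply: BD.
have := rpredD (rpredD (sB (BD uB wB) xmB) (sB uB wB)) (s_mult xmB).
rewrite -qE => h; apply: int_congr h _.
by rewrite /m intrB intrD -!pmulrn; ring.
Qed.

Let s'E y : y \in B -> s' y = s y.
Proof.
move=> yB; rewrite /s'; have -> : idx y = 0%N.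
  by rewrite /idx; case: r r_gt0 => // r' _ /=; rewrite mulr0n subr0 yB.
by rewrite mulr0n subr0 mul0r addr0.
Qed.

Lemma extend_once : exists C s1, [/\ subgroup C, additive_mod1 C s1,
  B \subset C, x \in C & {in B, s1 =1 s}].
Proof. by exists adjoin, s'; split=> // y yB; apply: s'E. Qed.

End Step.

(** Elements are adjoined one at a time by [extend_once] until B is the whole group. *)
Lemma extend_character B s : subgroup B -> additive_mod1 B s ->
  exists s1, (forall x y, s1 (x + y) - s1 x - s1 y \in Num.int)
             /\ {in B, s1 =1 s}.
Proof.
have [m] := ubnP (#|A| - #|B|)%N; elim: m B s => // m IH B s ltm Bsub sB.
have [BT|] := boolP ([set: A] \subset B).
  by exists s; split=> // x y; apply: sB; apply: (subsetP BT).
case/subsetPn => x _ xB.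
have [C [s1 [Csub s1C BC xC s1E]]] := extend_once x Bsub sB.
have ltBC : (#|B| < #|C|)%N by apply/proper_card/properP; split=> //; exists x.
have leC : (#|C| <= #|A|)%N by exact: max_card.
have [|s2 [s2a s2E]] := IH C s1 _ Csub s1C; first by lia.
by exists s2; split=> // y yB; rewrite s2E ?(subsetP BC) ?s1E.
Qed.

(* Pontryagin duality: psi factors through multiplication by L, hence gives
   a character Lx |-> psi x / p of LA, and M = pL kills any extension of it. *)
Lemma lift_or_torsion (p L : nat) (psi : A -> int) : (0 < p)%N ->
  (forall x y, (p %| psi (x + y) - psi x - psi y)%Z) ->
  (exists g, g *+ L = 0 /\ ~~ (p %| psi g)%Z) \/
  (exists s : A -> int, (forall x y, ((p * L)%N %| s (x + y) - s x - s y)%Z) /\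
                        (forall x, (p %| s x - psi x)%Z)).
Proof.
move=> p_gt0 psiD.
have p0 : p%:R != 0 :> rat by rewrite pnatr_eq0 -lt0n.
have intP (z : int) : (p %| z)%Z = (z%:~R / p%:R \in (Num.int : {pred rat})).
  apply/dvdzP/intrP => -[q E]; exists q.
    by rewrite E intrM -pmulrn mulfK.
  apply/eqP; rewrite -(eqr_int rat) intrM -pmulrn -E divfK //.
have [/existsP[g /andP[/eqP gL gp]]|/existsPn tors] :=
  boolP [exists g : A, (g *+ L == 0) && ~~ (p %| psi g)%Z].
  by left; exists g.
right.
have psi_tors x : x *+ L = 0 -> (p %| psi x)%Z.
  by move=> xL; have := tors x; rewrite xL eqxx negbK.
pose B : {set A} := [set x *+ L | x : A].
(* A chosen preimage under multiplication by L; the default 0 occurs only off B. By [psi_eq] the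
   choice does not matter modulo p. *)
pose pre y : A := odflt 0 [pick x | x *+ L == y].
have preP y : y \in B -> pre y *+ L = y.
  case/imsetP => x _ ->; rewrite /pre; case: pickP => [z /eqP //|/(_ x)].
  by rewrite eqxx.
have Bsub : subgroup B.
  split; first by apply/imsetP; exists 0; rewrite // mul0rn.
  move=> _ _ /imsetP[x _ ->] /imsetP[y _ ->].
  by rewrite -mulrnBl; apply/imsetP; exists (x - y).
have psi_eq x y : x *+ L = y *+ L -> (p %| psi x - psi y)%Z.
  move=> E; have /psi_tors h : (x - y) *+ L = 0 by rewrite mulrnBl E subrr.
  have := rpredD (psiD (x - y) y) h; rewrite subrK => h'.
  by have -> : psi x - psi y = psi x - psi (x - y) - psi y + psi (x - y) by ring.
pose s0 y : rat := (psi (pre y))%:~R / p%:R.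
have s0a : additive_mod1 B s0.
  move=> x y xB yB; rewrite /s0 -!mulrBl -!intrB -intP.
  have h : (p %| psi (pre (x + y)) - psi (pre x + pre y))%Z.
    apply: psi_eq; rewrite preP ?mulrnDl ?preP //.
    case/imsetP: xB => a _ ->; case/imsetP: yB => b _ ->.
    by rewrite -mulrnDl; apply/imsetP; exists (a + b).
  have -> : psi (pre (x + y)) - psi (pre x) - psi (pre y) =
    psi (pre (x + y)) - psi (pre x + pre y) +
    (psi (pre x + pre y) - psi (pre x) - psi (pre y)) by ring.
  by rewrite rpredD.
have [s1 [s1a s1E]] := extend_character Bsub s0a.
have s1z : s1 0 \in Num.int.
  by have := s1a 0 0; rewrite addr0 subrr sub0r rpredN.
have s1M x m : s1 (x *+ m) - m%:R * s1 x \in Num.int.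
  elim: m => [|m IH]; first by rewrite mulr0n mul0r subr0.
  apply: int_congr (rpredD (s1a x (x *+ m)) IH) _; rewrite mulrS.
  by rewrite -natr1; ring.
(* Modulo 1, L s1(x) = s1(Lx) = psi x / p. Hence p L s1 takes integer values and agrees with psi
   modulo p. *)
have s1L x : L%:R * s1 x - (psi x)%:~R / p%:R \in Num.int.
  have xB : x *+ L \in B by apply/imsetP; exists x.
  have h : (psi (pre (x *+ L)) - psi x)%:~R / p%:R \in (Num.int : {pred rat}).
    by rewrite -intP; apply: psi_eq; rewrite preP.
  have := rpredB h (s1M x L); rewrite s1E // /s0 => h'.
  by apply: int_congr h' _; rewrite intrB; field.
have s1int x : p%:R * L%:R * s1 x \in Num.int.
  have h := rpredM (natr_int _ p) (s1L x).
  have h2 : (psi x)%:~R \in (Num.int : {pred rat}) by apply: intr_int.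
  by apply: int_congr (rpredD h h2) _; field.
pose s x : int := Num.floor (p%:R * L%:R * s1 x).
have sE x : (s x)%:~R = p%:R * L%:R * s1 x by rewrite /s floorK.
exists s; split=> [x y|x].
  have /intrP[q E] := s1a x y; apply/dvdzP; exists q.
  apply/eqP; rewrite -(eqr_int rat) !intrB !sE; rewrite intrM -pmulrn natrM -E; apply/eqP; ring.
by rewrite intP; apply: int_congr (s1L x) _; rewrite intrB sE; field.
Qed.

End CharacterExtension.

(** * Counting in a fibre *)

HB.instance Definition _ (U V : finZmodType) := GRing.Zmodule.on (U * V)%type.
HB.instance Definition _ (U : finZmodType) (m n : nat) :=
  GRing.Zmodule.on 'M[U]_(m, n).

Lemma mem_iter_sumset (V : finZmodType) (X D : {set V}) u v m :
  u \in X -> v \in D -> u + v *+ m \in iter_sumset X D m.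
Proof.
move=> uX vD; elim: m => [|m IH]; first by rewrite mulr0n addr0.
by rewrite mulrSr addrA; apply: mem_sumset.
Qed.

Lemma intr_Zp_eq0 (M : nat) (z : int) : (1 < M)%N ->
  (z%:~R == 0 :> 'Z_M) = (M %| z)%Z.
Proof.
move=> M_gt1.
have natE m : (m%:R == 0 :> 'Z_M) = (M %| m)%N.
  by rewrite -(inj_eq val_inj) /= val_Zp_nat.
case: z => m; first by rewrite -pmulrn natE.
by rewrite NegzE mulrNz oppr_eq0 -pmulrn natE dvdzE abszN.
Qed.

Section Fibre.
Variables (A : finZmodType) (p L n : nat).
Hypotheses (p_pr : prime p) (L_gt0 : (0 < L)%N).
Let M := (p * L)%N.
Let row := 'rV[A]_n.
Let vals := 'rV['Z_M]_n.

Let M_gt1 : (1 < M)%N.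
Proof. by apply: leq_trans (prime_gt1 p_pr) _; rewrite leq_pmulr. Qed.

Variables (a : A -> int) (g : A).
Hypothesis a_add : forall x y, (p %| a (x + y) - a x - (a y - a 0%R))%Z.
Hypotheses (gL : g *+ L = 0) (a_g : ~~ (p %| a g - a 0%R)%Z).

Definition shift (x : row) (w : {ffun 'I_n -> 'I_p}) : row :=
  \row_i (x 0 i + g *+ w i).

Let shiftMn x w : shift x w *+ L = x *+ L.
Proof.
by apply/rowP=> i; rewrite !mulmxnE mxE mulrnDl -mulrnA mulnC mulrnA gL mul0rn addr0.
Qed.

Let a_mul x m : (p %| a (x + g *+ m) - a x - m%:Z * (a g - a 0%R))%Z.
Proof.
elim: m => [|m IH]; first by rewrite mulr0n addr0 subrr mul0r subr0 dvdz0.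
have := rpredD (a_add (x + g *+ m) g) IH; rewrite -[x + _ + g]addrA -mulrSr.
by congr (_ %| _)%Z; rewrite intS; ring.
Qed.

Variables F G H : row -> vals.
Hypothesis F_mod : forall x i, exists q : int, F x 0 i = (p%:Z * q - a (x 0 i))%:~R.

(* LF(x) mod pL only depends on F(x) mod p, which is prescribed by a. *)
Let shift_inj x w w' : F (shift x w) *+ L = F (shift x w') *+ L -> w = w'.
Proof.
move=> /rowP E; apply/ffunP=> i; have := E i; rewrite !mulmxnE.
have [q ->] := F_mod (shift x w) i; have [q' ->] := F_mod (shift x w') i.
rewrite !mxE => /eqP; rewrite -!rmorphMn -subr_eq0 -rmorphB intr_Zp_eq0 //=.
rewrite -mulrnBl -mulr_natr natz /M PoszM dvdz_mul2r ?eqz_nat -?lt0n // => h.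
have := rpredB (rpredD h (rpredB (a_mul (x 0 i) (w i)) (a_mul (x 0 i) (w' i))))
               (dvdz_mulr (q - q') (dvdzz p)).
set z := (X in X \in _) => {}h.
have {h} : (p %| ((w' i)%:Z - (w i)%:Z) * (a g - a 0%R))%Z.
  by have -> : ((w' i)%:Z - (w i)%:Z) * (a g - a 0%R) = z by rewrite /z; ring.
rewrite dvdzE abszM Euclid_dvdM //; move: a_g; rewrite dvdzE => /negPf->.
rewrite orbF -dvdzE -eqz_mod_dvd => /eqP.
rewrite !modz_small ?lez_nat ?ltz_nat ?ltn_ord //= => -[E'].
by apply/val_inj.
Qed.

Lemma row_card_gt0 : (0 < #|row|)%N.
Proof. by apply/card_gt0P; exists 0. Qed.

(** Averaging over x: for fixed w the map x -> [shift x w] is a translation, so the fibre counts sum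
    to p^n |B|. *)
Let popular_fibre (B : {set row}) (K : nat) : (#|row| <= 4 * K * #|B|)%N ->
  exists x, (p ^ n <= 4 * K * #|[set w | shift x w \in B]|)%N.
Proof.
move=> cB; apply/existsP; apply: contraLR isT => /existsPn h.
have card_w : #|{ffun 'I_n -> 'I_p}| = (p ^ n)%N by rewrite card_ffun !card_ord.
have sumE : (\sum_(x : row) #|[set w | shift x w \in B]| = p ^ n * #|B|)%N.
  under eq_bigr => x _ do rewrite -sum1_card big_mkcond.
  rewrite exchange_big /= -card_w -sum_nat_const; apply: eq_bigr => w _.
  pose u : row := \row_i (g *+ w i).
  have shiftE x : shift x w = x + u by apply/rowP => i; rewrite !mxE.
  rewrite -big_mkcond /= sum1_card -[RHS](card_translate _ (- u)).
  apply: eq_card => x; rewrite -[LHS]/(w \in [set w0 | shift x w0 \in B]) inE shiftE.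
  apply/idP/imsetP => [xB|[y yB ->]].
    by exists (x + u); rewrite // addrK.
  by rewrite subrK.
have : (\sum_(x : row) (4 * K * #|[set w | shift x w \in B]|).+1 <=
        \sum_(x : row) p ^ n)%N.
  by apply: leq_sum => x _; rewrite ltnNge h.
under eq_bigr => x _ do rewrite -addn1.
rewrite big_split /= -big_distrr /= !sum_nat_const muln1 sumE.
move=> le1; have {}le1 : (4 * K * (p ^ n * #|B|) + #|row| <= #|row| * p ^ n)%N := le1.
have := leq_mul cB (leqnn (p ^ n)); have := row_card_gt0.
by move: le1; move: #|row| #|B| (p ^ n)%N => R b P; lia.
Qed.

Let V : finZmodType := ('rV[A]_n * 'rV['Z_M]_n)%type.

Lemma dense_solutions_bound K :
  (#|row| ^ 2 <=
   K * #|[set q : row * row | (G q.1 + F q.2 + H (- q.1 - q.2) == 0)%R]|)%N ->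
  (p ^ n <= 4 * K * (288 * 256 * K ^ 6) ^ L)%N.
Proof.
move=> dense.
pose phi (y : row) : V := (y, G y); pose theta (x : row) : V := (x, F x).
(* The reflected graph of H: G(y) + F(x) + H(-y - x) = 0 puts (y, G y) + (x, F x) in S. *)
pose S : {set V} := [set (- z, - H z) | z : row].
have phi_inj : injective phi by move=> x y [].
have theta_inj : injective theta by move=> x y [].
have [||A' [B' [A'0 cB' small]]] := balog_szemeredi_gowers (K := K) (S := S)
  row_card_gt0 _ phi_inj theta_inj.
- exact: leq_imset_card.
- apply: leq_trans dense _; rewrite leq_mul2l; apply/orP; right.
  apply/subset_leq_card/subsetP => -[y x]; rewrite !inE /= => /eqP E.
  apply/imsetP; exists (- y - x) => //; rewrite opprD !opprK.
  by congr pair; apply/eqP; rewrite -subr_eq0 opprK; apply/eqP.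
have phiA0 : phi @: A' != set0 by rewrite imset_eq0.
have [X [XA X0 iterX]] := plunnecke phiA0 small.
have [x xB] := popular_fibre cB'.
set C := [set w | _] in xB.
pose D := theta @: B'.
(* Injective on X x C: the first coordinate is y + L x, which determines the point of X since X lies
   in the graph of G; the second then determines w by [shift_inj]. *)
pose f (q : V * {ffun 'I_n -> 'I_p}) : V := q.1 + theta (shift x q.2) *+ L.
have f_inj : {in setX X C &, injective f}.
  move=> [v w] [v' w'] /setXP[/= vX _] /setXP[/= v'X _].
  case/(subsetP XA)/imsetP: vX => y _ ->; case/(subsetP XA)/imsetP: v'X => y' _ ->.
  rewrite /f /= => E.
  have fstMn (u : V) m : (u *+ m).1 = u.1 *+ m.
    by elim: m => // m IH; rewrite !mulrS -IH.
  have sndMn (u : V) m : (u *+ m).2 = u.2 *+ m.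
    by elim: m => // m IH; rewrite !mulrS -IH.
  have := congr1 fst E; rewrite /= !fstMn /= !shiftMn => /addIr yy'.
  have := congr1 snd E; rewrite /= !sndMn /= yy' => /addrI/shift_inj-> //.
have : (#|X| * #|C| <= #|iter_sumset X D L|)%N.
  rewrite -cardsX -(card_in_imset f_inj); apply/subset_leq_card/subsetP.
  move=> u /imsetP[[v w] /setXP[/= vX]]; rewrite inE => wC ->.
  by apply: mem_iter_sumset => //; apply: imset_f.
have X_gt0 : (0 < #|X|)%N by rewrite card_gt0.
move/leq_trans/(_ (iterX L)); rewrite mulnC leq_pmul2r // => cC.
by apply: leq_trans xB _; rewrite leq_mul2l cC orbT.
Qed.
End Fibre.

(** * Consequences of minimality *)

Lemma dvdz_natP (d m n : nat) : (m = n %[mod d])%N <-> (d %| m%:Z - n%:Z)%Z.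
Proof. by rewrite -eqz_mod_dvd !modz_nat eqz_nat; split=> /eqP. Qed.

Section Minimality.
Variables (A : finZmodType) (p k : nat) (t : A -> A -> A -> 'Z_(p ^ k)).
Hypotheses (p_pr : prime p) (k_gt0 : (1 <= k)%N).

(** Integer solutions, convenient for subtraction, are reduced modulo p^k N to natural
    representatives. *)
Lemma admissible_int (N : nat) (a b c : A -> int) : (0 < N)%N ->
  (forall x y z, x + y + z = 0 ->
     ((p ^ k * N)%N %| a x + b y + c z - (N * (t x y z : nat))%:Z)%Z) ->
  admissible t N.
Proof.
move=> N_gt0 h; set M := (p ^ k * N)%N in h.
have M0 : M%:Z != 0.
  by rewrite eqz_nat -lt0n muln_gt0 N_gt0 expn_gt0 prime_gt0.
pose red (u : A -> int) x := `|(u x %% M)%Z|%N.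
have redE u x : (M %| (red u x)%:Z - u x)%Z.
  by rewrite -eqz_mod_dvd /red gez0_abs ?modz_ge0 // modz_mod.
exists (red a), (red b), (red c) => x y z xyz; apply/dvdz_natP.
rewrite -/M !PoszD.
have := rpredD (rpredD (rpredD (redE a x) (redE b y)) (redE c z)) (h x y z xyz).
set u := (X in X \in _) => hu.
by have <- : u = (red a x)%:Z + (red b y)%:Z + (red c z)%:Z
  - (N * (t x y z : nat))%:Z by rewrite /u; ring.
Qed.

Variable N : nat.
Hypotheses (N_gt1 : (1 < N)%N) (N_adm : admissible t N).
Hypothesis N_min : forall M, (0 < M)%N -> admissible t M -> (N <= M)%N.

Lemma not_admissible1 : ~ admissible t 1.
Proof. by move/(N_min (ltn0Sn 0)); rewrite leqNgt N_gt1. Qed.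

(** Otherwise N is invertible modulo p^k, and multiplying a, b, c by its inverse makes 1
    admissible. *)
Lemma prime_dvd_minimal : (p %| N)%N.
Proof.
apply/negPn/negP => pN; apply: not_admissible1.
have cop : coprime N (p ^ k) by rewrite coprimeXr // coprime_sym prime_coprime.
have N_gt0 : (0 < N)%N by apply: ltnW.
case: (egcdnP (p ^ k) N_gt0) => u v; rewrite (eqP cop) => uE _.
case: N_adm => a [b [c h]].
exists (fun x => u * a x)%N, (fun y => u * b y)%N, (fun z => u * c z)%N => x y z xyz.
rewrite muln1 mul1n -!mulnDr.
have h' : (a x + b y + c z = N * t x y z %[mod p ^ k])%N.
  by rewrite -(modn_dvdm _ (dvdn_mulr N (dvdnn _))) h // modn_dvdm // dvdn_mulr.
rewrite -modnMmr h' modnMmr mulnA uE mulnDl mul1n -modnDml.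
by rewrite -mulnA mulnCA modnMr add0n.
Qed.

Let N1 := (N %/ p)%N.
Let NE : N = (p * N1)%N.
Proof. by rewrite mulnC divnK // prime_dvd_minimal. Qed.
Let L := (p ^ k * N1)%N.

(** Since p divides N, the equation modulo p has right side 0 and makes a - a 0 additive modulo p.
    In the lifting case of [lift_or_torsion], N / p would be admissible. *)
Lemma exists_torsion : exists a b c : A -> int, exists g : A,
  [/\ forall x y z, x + y + z = 0 ->
        ((p * L)%N %| a x + b y + c z - (N * (t x y z : nat))%:Z)%Z,
      forall x y, (p %| a (x + y) - a x - (a y - a 0%R))%Z,
      g *+ L = 0 & ~~ (p %| a g - a 0%R)%Z].
Proof.
case: N_adm => a0 [b0 [c0 h0]].
pose a x : int := a0 x; pose b x : int := b0 x; pose c x : int := c0 x.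
have ME : (p ^ k * N = p * L)%N by rewrite NE mulnCA.
have h x y z : x + y + z = 0 ->
    ((p * L)%N %| a x + b y + c z - (N * (t x y z : nat))%:Z)%Z.
  by move=> /h0/dvdz_natP; rewrite ME !PoszD.
have hp x y z : x + y + z = 0 -> (p %| a x + b y + c z)%Z.
  move=> /h hM; have pM : (p %| (p * L)%N%:Z)%Z by rewrite dvdzE /= dvdn_mulr.
  have pN : (p %| (N * (t x y z : nat))%:Z)%Z.
    by rewrite dvdzE /= dvdn_mulr // prime_dvd_minimal.
  by have := rpredD (dvdz_trans pM hM) pN; rewrite subrK.
(* The triples (0, y, -y) and (y, 0, -y) show that a and b agree modulo p up to constants. *)
have h1 y : (p %| b y - b 0%R - (a y - a 0%R))%Z.
  have e1 : 0 + y + - y = 0 by rewrite add0r subrr.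
  have e2 : y + 0 + - y = 0 by rewrite addr0 subrr.
  have := rpredB (hp _ _ _ e1) (hp _ _ _ e2).
  set u := (X in X \in _) => hu.
  by have -> : b y - b 0%R - (a y - a 0%R) = u by rewrite /u; ring.
have a_add x y : (p %| a (x + y) - a x - (a y - a 0%R))%Z.
  have e1 : x + y + - (x + y) = 0 by rewrite subrr.
  have e2 : x + y + 0 + - (x + y) = 0 by rewrite addr0 subrr.
  have := rpredD (rpredB (hp _ _ _ e2) (hp _ _ _ e1)) (h1 y).
  set u := (X in X \in _) => hu.
  by have -> : a (x + y) - a x - (a y - a 0%R) = u by rewrite /u; ring.
have psi_add x y : (p %| (a (x + y) - a 0%R) - (a x - a 0%R) - (a y - a 0%R))%Z.
  have := a_add x y; set u := (X in X \in _) => hu.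
  by have -> : (a (x + y) - a 0%R) - (a x - a 0%R) - (a y - a 0%R) = u
    by rewrite /u; ring.
have [[g [gL pg]]|[s [s_add s_psi]]] :=
  lift_or_torsion L (psi := fun x => a x - a 0%R) (prime_gt0 p_pr) psi_add.
  by exists a, b, c, g.
have N1_gt0 : (0 < N1)%N by rewrite divn_gt0 ?prime_gt0 // dvdn_leq ?prime_dvd_minimal // ltnW.
suff /(N_min N1_gt0) : admissible t N1.
  by rewrite leqNgt ltn_Pdiv ?prime_gt1 // ltnW.
(* Moving the constants a 0 and b 0 into c and subtracting the lift s makes all three functions
   divisible by p; their sum changes only by a multiple of p L, since s sums to 0 there. *)
pose al x := a x - a 0%R - s x.
pose be y := b y - b 0%R - s y.
pose ga z := c z + a 0%R + b 0%R - s z.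
have al_p x : (p %| al x)%Z.
  have := s_psi x; rewrite -rpredN; set u := (X in X \in _) => hu.
  by have -> : al x = u by rewrite /al /u; ring.
have be_p y : (p %| be y)%Z.
  have := rpredD (h1 y) (al_p y); set u := (X in X \in _) => hu.
  by have -> : be y = u by rewrite /be /u /al; ring.
have s0 : ((p * L)%N %| s 0%R)%Z.
  have h00 := s_add 0%R 0%R; rewrite addr0 in h00.
  by rewrite -rpredN; move: h00; rewrite addrN add0r.
have s_sum x y z : x + y + z = 0 -> ((p * L)%N %| s x + s y + s z)%Z.
  move=> xyz; have := rpredB s0 (rpredD (s_add x y) (s_add (x + y) z)).
  rewrite xyz; set u := (X in X \in _) => hu.
  by have -> : s x + s y + s z = u by rewrite /u; ring.
have ga_p z : (p %| ga z)%Z.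
  have e : 0 + - z + z = 0 by rewrite add0r addNr.
  have ps : (p %| s 0%R + s (- z)%R + s z)%Z.
    by apply: dvdz_trans (s_sum _ _ _ e); rewrite dvdzE /= dvdn_mulr.
  have ps0 : (p %| s 0%R)%Z by apply: dvdz_trans s0; rewrite dvdzE /= dvdn_mulr.
  have := rpredD (rpredB (rpredB (hp _ _ _ e) (be_p (- z))) ps) ps0.
  set u := (X in X \in _) => hu.
  by have -> : ga z = u by rewrite /ga /u /be; ring.
apply: (@admissible_int N1 (fun x => (al x %/ p)%Z) (fun y => (be y %/ p)%Z)
                           (fun z => (ga z %/ p)%Z)) => // x y z xyz.
have p0 : p%:Z != 0 by rewrite eqz_nat -lt0n prime_gt0.
rewrite -/L -(dvdz_mul2l p0) -PoszM.
have := rpredB (h x y z xyz) (s_sum x y z xyz); set u := (X in X \in _) => hu.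
have -> : p%:Z * ((al x %/ p)%Z + (be y %/ p)%Z + (ga z %/ p)%Z
                  - (N1 * (t x y z : nat))%:Z) = u => //.
rewrite mulrBr !mulrDr ![p%:Z * (_ %/ _)%Z]mulrC !divzK // -PoszM mulnA -NE.
by rewrite /u /al /be /ga; ring.
Qed.

End Minimality.

(** * Counting successful triples and concluding *)

Lemma card_zero_sum_triples (A : finZmodType) (n : nat) :
  #|zero_sum_triples A n| = (#|A| ^ n * #|A| ^ n)%N.
Proof.
pose f (q : 'rV[A]_n * 'rV[A]_n) := (q.1, q.2, - (q.1 + q.2)).
have f_inj : injective f by move=> [x y] [x' y'] [-> ->].
have -> : zero_sum_triples A n = f @: setT.
  apply/setP => -[[x y] z]; rewrite inE /=; apply/eqP/imsetP => [xyz|[[x' y'] _ [-> -> ->]]].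
    by exists (x, y); rewrite // /f /=; congr (_, _); apply/eqP; rewrite -addr_eq0 [z + _]addrC xyz.
  by rewrite subrr.
by rewrite card_imset // cardsT card_prod card_mx mul1n.
Qed.

Section Bounds.
Variables (A : finZmodType) (p k : nat) (t : A -> A -> A -> 'Z_(p ^ k)) (N : nat).
Hypotheses (p_pr : prime p) (k_gt0 : (1 <= k)%N).
Hypotheses (N_gt1 : (1 < N)%N) (N_adm : admissible t N).
Hypothesis N_min : forall M, (0 < M)%N -> admissible t M -> (N <= M)%N.

Let pk_gt1 : (1 < p ^ k)%N.
Proof. by rewrite -(exp1n k) ltn_exp2r // prime_gt1. Qed.

(** N times a congruence modulo p^k holds modulo p^k N = p L; subtracting the equation for a, b, c
    turns each good triple into a zero of the lifted sum. The bound p^n is weakened to 2^n. *)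
Lemma good_triples_bound n (f g h : 'rV[A]_n -> 'rV['Z_(p ^ k)]_n) (K : nat) :
  (#|zero_sum_triples A n| <= K * #|good_triples t f g h|)%N ->
  (2 ^ n <= 4 * K * (288 * 256 * K ^ 6) ^ (p ^ k * (N %/ p)))%N.
Proof.
have pN := prime_dvd_minimal p_pr N_gt1 N_adm N_min.
have [a [b [c [x0 [abc a_add x0L a_x0]]]]] := exists_torsion p_pr N_gt1 N_adm N_min.
set L := (p ^ k * (N %/ p))%N in abc x0L *.
have L_gt0 : (0 < L)%N.
  by rewrite muln_gt0 expn_gt0 prime_gt0 // divn_gt0 ?prime_gt0 // dvdn_leq // ltnW.
have ME : (p * L = p ^ k * N)%N by rewrite /L mulnCA; congr muln; rewrite mulnC divnK.
have M_gt1 : (1 < p * L)%N.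
  by apply: leq_trans (prime_gt1 p_pr) _; rewrite leq_pmulr.
pose lift (u : A -> int) (v : 'rV[A]_n -> 'rV['Z_(p ^ k)]_n) x : 'rV['Z_(p * L)]_n :=
  \row_i ((N * (v x ord0 i : nat))%:Z - u (x ord0 i))%:~R.
have lift_mod x i : exists q : int, lift a f x 0 i = (p%:Z * q - a (x 0 i))%:~R.
  exists (N %/ p * (f x 0%R i : nat))%N%:Z; rewrite mxE -PoszM mulnA.
  by rewrite [(p * (N %/ p))%N]mulnC divnK.
have good_lift x y z : (x, y, z) \in good_triples t f g h ->
    lift b g y + lift a f x + lift c h z = 0.
  rewrite !inE /= => /andP[/eqP xyz /forallP good]; apply/rowP => i.
  rewrite !mxE -!rmorphD /=; apply/eqP; rewrite intr_Zp_eq0 //.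
  have xyz_i : x ord0 i + y ord0 i + z ord0 i = 0.
    by move/rowP/(_ i): xyz; rewrite !mxE.
  have := good i; set u := f x _ i; set v := g y _ i; set w := h z _ i.
  set s := t _ _ _ => /eqP uvw.
  have : ((p ^ k)%N %| (u + v + w)%N%:Z - (s : nat)%:Z)%Z.
    rewrite -intr_Zp_eq0 // rmorphB /= -!pmulrn !natrD !natr_Zp uvw subrr //.
  move/(dvdz_mul (dvdzz N)); rewrite mulrC -PoszM mulnC -ME => h1.
  have he := rpredB h1 (abc _ _ _ xyz_i); rewrite -/s in he.
  set e := (X in X \in _) in he.
  suff -> : (N * v)%:Z - b (y ord0 i) + ((N * u)%:Z - a (x ord0 i)) +
            ((N * w)%:Z - c (z ord0 i)) = e by [].
  by rewrite /e !PoszM !PoszD; ring.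
move=> dense.
apply: (@leq_trans (p ^ n)).
  by case: (n) => // m; rewrite leq_exp2r // prime_gt1.
apply: (@dense_solutions_bound A p L n p_pr L_gt0 a x0 a_add x0L a_x0
         (lift a f) (lift b g) (lift c h) lift_mod).
rewrite card_mx mul1n -mulnn -card_zero_sum_triples.
apply: leq_trans dense _; rewrite leq_mul2l; apply/orP; right.
pose tr (q : 'rV[A]_n * 'rV[A]_n) := (q.2, q.1, - q.1 - q.2).
apply: leq_trans (leq_imset_card tr _).
apply/subset_leq_card/subsetP => -[[x y] z] xyz_good; apply/imsetP.
have zE : z = - y - x.
  move: (xyz_good); rewrite !inE /= => /andP[/eqP xyz _].
  by rewrite -opprD [y + x]addrC; apply/eqP; rewrite -addr_eq0 [z + _]addrC xyz.
by exists (y, x); rewrite /tr -?zE // inE /= -zE good_lift.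
Qed.

(** If all triples were good, coordinate 0 on constant rows would make 1 admissible. *)
Lemma good_triples_lt n (f g h : 'rV[A]_n -> 'rV['Z_(p ^ k)]_n) : (0 < n)%N ->
  (#|good_triples t f g h| < #|zero_sum_triples A n|)%N.
Proof.
case: n f g h => // n f g h _.
have sub : good_triples t f g h \subset zero_sum_triples A n.+1.
  by apply/subsetP => w; rewrite inE => /andP[].
apply: proper_card; rewrite properEneq sub andbT; apply/eqP => E.
apply: (not_admissible1 N_gt1 N_min).
pose cst (x : A) : 'rV[A]_n.+1 := const_mx x.
exists (fun x => f (cst x) 0 0), (fun y => g (cst y) 0 0), (fun z => h (cst z) 0 0).
move=> x y z xyz; rewrite muln1 mul1n.
have : (cst x, cst y, cst z) \in zero_sum_triples A n.+1.
  by rewrite inE /=; apply/eqP/rowP => i; rewrite !mxE.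
rewrite -E inE => /andP[_ /forallP /(_ 0)] /=; rewrite !mxE.
set s := t x y z; set u := f _ _ _; set v := g _ _ _; set w := h _ _ _ => /eqP uvw.
apply/dvdz_natP; rewrite -intr_Zp_eq0 // rmorphB /= -!pmulrn !natrD !natr_Zp uvw.
by rewrite subrr.
Qed.

(** [good_triples_bound] is applied with K just above Z / G, where Z and G count all and good
    triples; G = 0 is treated apart. *)
Lemma good_triples_power : exists C E : nat, (0 < C)%N /\ (0 < E)%N /\
  forall n (f g h : 'rV[A]_n -> 'rV['Z_(p ^ k)]_n),
    (2 ^ n * #|good_triples t f g h| ^ C <= E * #|zero_sum_triples A n| ^ C)%N.
Proof.
pose L := (p ^ k * (N %/ p))%N.
(* The bound has degree 6L + 1 in K, and 2^(6L + 1) pays for rounding through K G <= 2 Z. *)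
exists (6 * L).+1, (4 * (288 * 256) ^ L * 2 ^ (6 * L).+1)%N; split=> //.
split=> [|n f g h]; first by rewrite !muln_gt0 !expn_gt0.
set Z := #|zero_sum_triples A n|; set G := #|good_triples t f g h|.
have [G0|G_gt0] := posnP G; first by rewrite G0 exp0n // muln0.
have GZ : (G <= Z)%N.
  by apply/subset_leq_card/subsetP => w; rewrite inE => /andP[].
pose K := (Z %/ G).+1.
have KG : (K * G <= 2 * Z)%N.
  by rewrite /K mulSn; have := leq_divM Z G; lia.
have := @good_triples_bound n f g h K (ltnW (ltn_ceil Z G_gt0)).
rewrite -/L expnMn -expnM => bound.
apply: leq_trans (leq_mul bound (leqnn _)) _.
rewrite -!mulnA -expnMn [X in (_ <= X)%N]mulnCA.
have -> : (4 * (K * ((288 * 256) ^ L * (K ^ (6 * L) * G ^ (6 * L).+1))) =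
           4 * ((288 * 256) ^ L * (K * G) ^ (6 * L).+1))%N.
  rewrite [((K * G) ^ _)%N]expnMn [(K ^ (6 * L).+1)%N]expnS.
  by move: ((288 * 256) ^ L)%N (K ^ (6 * L))%N (G ^ _)%N => u v w; lia.
by rewrite [X in (_ <= X)%N]mulnCA !leq_mul2l /= leq_exp2r // KG !orbT.
Qed.

End Bounds.

Lemma INR_expn (m n : nat) : INR (m ^ n) = pow (INR m) n.
Proof. by elim: n => // n IH; rewrite expnS mult_INR IH. Qed.

Local Close Scope ring_scope.
Unset Implicit Arguments.

Theorem theorem2p4 (A : finZmodType) (p k : nat) (t : A -> A -> A -> 'Z_(p ^ k))
  (N : nat) :
  prime p -> (1 <= k)%N ->
  (0 < N)%N -> admissible t N ->
  (forall M : nat, (0 < M)%N -> admissible t M -> (N <= M)%N) ->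
  (1 < N)%N ->
  exists c : R, Rlt 0 c /\
    forall (n : nat) (f g h : 'rV[A]_n -> 'rV['Z_(p ^ k)]_n),
      Rle (success_prob t f g h) (Rpower 2 (Ropp (Rmult c (INR n)))).
Proof.
move=> p_pr k_gt0 _ N_adm N_min N_gt1.
have [C [E [C_gt0 [E_gt0 bound]]]] := good_triples_power p_pr k_gt0 N_gt1 N_adm N_min.
have A_gt0 : (0 < #|A|)%N by apply/card_gt0P; exists 0%R.
(* For n < 2E there are |A|^(2n) <= |A|^(4E) triples and at least one fails, so this is the Q of
   [exponential_decay]. *)
have Q_gt0 : (0 < #|A| ^ (4 * E))%N by rewrite expn_gt0 A_gt0.
have [c [c_gt0 decay]] :=
  exponential_decay C E _ (elimT ltP C_gt0) (elimT ltP E_gt0) (elimT ltP Q_gt0).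
exists c; split=> // n f g h; apply: decay; rewrite /success_prob.
all: set G := #|good_triples _ _ _ _|; set Z := #|zero_sum_triples _ _|.
all: have ZE : Z = (#|A| ^ n * #|A| ^ n)%N by apply: card_zero_sum_triples.
all: have Z_gt0 : Rlt 0 (INR Z)
  by apply: lt_0_INR; apply/ltP; rewrite ZE muln_gt0 expn_gt0 A_gt0.
all: have GZ : Rle (INR G) (INR Z)
  by apply/le_INR/leP/subset_leq_card/subsetP => w; rewrite inE => /andP[].
- split; first exact: Rle_mult_inv_pos (pos_INR _) Z_gt0.
  apply: (Rmult_le_reg_r (INR Z)) => //.
  by rewrite /Rdiv Rmult_assoc Rinv_l ?Rmult_1_r ?Rmult_1_l //; apply: Rgt_not_eq.
- have /leP/le_INR := bound n f g h.
  rewrite -/G -/Z !mult_INR !INR_expn => le.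
  rewrite /Rdiv Rpow_mult_distr pow_inv -Rmult_assoc.
  apply: (Rmult_le_reg_r (pow (INR Z) C)); first exact: pow_lt.
  rewrite Rmult_assoc Rinv_l ?Rmult_1_r //.
  exact/pow_nonzero/Rgt_not_eq.
- case=> n_gt0 n_lt.
  have /leP/le_INR : (G.+1 <= Z)%N
    by apply: (good_triples_lt p_pr k_gt0 N_gt1 N_min); apply/ltP.
  rewrite S_INR => GZ1.
  have ZQ : Rle (INR Z) (INR (#|A| ^ (4 * E))).
    apply/le_INR/leP; rewrite ZE -expnD leq_pexp2l //; lia.
  have le1 : Rle (Rdiv (INR G) (INR Z)) (Rminus 1 (Rinv (INR Z))).
    apply: (Rmult_le_reg_r (INR Z)) => //.
    rewrite Rmult_minus_distr_r /Rdiv Rmult_assoc Rinv_l; last exact: Rgt_not_eq.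
    lra.
  have := Rinv_le_contravar _ _ Z_gt0 ZQ; lra.
Qed.
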